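(* There is a function $\varepsilon:(e,\infty)\to\mathbb{R}$ with $\varepsilon(x)\to 0$ as $x\to\infty$ such that the following holds. For all real numbers $Q,Q'\ge 1$ with $QQ'>e$ and all sets $A,B\subseteq \mathcal F_{Q,Q'}$, $$|A/B|\ge |A||B|\exp\left(-\bigl(2\sqrt{\log 2}+\varepsilon(QQ')\bigr)\frac{\log(QQ')}{\sqrt{\log\log(QQ')}}\right).$$
   Context: For real numbers $Q,Q'\ge 1$, $\mathcal F_{Q,Q'}=\{q/q' : q,q'\in\mathbb{Z},\ 1\le q\le Q,\ 1\le q'\le Q'\}$, a set of positive rational numbers. For sets $A,B$ of positive rationals, $A/B=\{a/b: a\in A,\ b\in B\}$. $\log$ denotes the natural logarithm. *)

(* Defs.v *)
From HB Require Import structures.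
From mathcomp Require Import all_boot all_order all_algebra.
From mathcomp Require Import finmap.
From mathcomp Require Import all_classical all_reals all_analysis.
Set Implicit Arguments. Unset Strict Implicit. Unset Printing Implicit Defensive.
Import Order.TTheory GRing.Theory Num.Theory.
Local Open Scope ring_scope.

Definition inF {R : realType} (Q Q' : R) (x : rat) : Prop :=
  exists q q' : nat, [/\ (1 <= q)%N, (q%:R <= Q), (1 <= q')%N, (q'%:R <= Q')
                        & x = q%:R / q'%:R].

Definition fsdiv (A B : {fset rat}) : {fset rat} :=
  [fset a / b | a in A, b in B]%fset.

(* Main.v *)
Require Import Defs.
From HB Require Import structures.
From mathcomp Require Import all_boot all_order all_algebra.
From mathcomp Require Import finmap.
From mathcomp Require Import all_classical all_reals all_analysis.
From mathcomp Require Import ring lra.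
Import Order.TTheory GRing.Theory Num.Theory.
Set Implicit Arguments.
Unset Strict Implicit.
Unset Printing Implicit Defensive.

(* Let x = Q Q'.  For reduced a = q/q' and b = s/s', the common factor of the
   numerator and denominator of a/b = (q s')/(q' s) is m = gcd(q,s) gcd(q',s').
   Given a/b and m, the integers q and q' are divisors of known integers <= x, so
   there are few pairs (a, b) with m <= M.  A pair with m > M makes a divisible
   by some d/d' with d | s, d' | s' and d d' > M; for each b there are at most
   max d(n) such d/d', and dividing the corresponding part of A by d/d' lowers
   its height from x to x/M without changing the number of quotients.  With
   M = x^(1/k) this stops after k steps, for a total loss of about
   x^(1/k) (max d(n))^k; one uses d(n) <= exp((log 2 + o(1)) log x / log log x)
   and k ~ sqrt(log log x / log 2). *)

(** * Counting the divisors of a natural number *)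

Lemma size_divisors_gt0 n : 0 < size (divisors n).
Proof. by case: (divisors n) (divisor1 n). Qed.

(** A divisor [d] of [m * n] is [gcdn d m] times a cofactor coprime to [m %/ gcdn d m], hence
    dividing [n]; so products of divisors exhaust the divisors of [m * n]. *)
Lemma size_divisorsM m n :
  size (divisors (m * n)) <= size (divisors m) * size (divisors n).
Proof.
have [->|m0] := posnP m; first
  by rewrite mul0n leq_pmulr // size_divisors_gt0.
have [->|n0] := posnP n; first
  by rewrite muln0 leq_pmull // size_divisors_gt0.
rewrite -(size_allpairs muln); apply: uniq_leq_size; first exact: divisors_uniq.
move=> d; rewrite -dvdn_divisors ?muln_gt0 ?m0 // => dvd_d.
have g0 : 0 < gcdn d m by rewrite gcdn_gt0 m0 orbT.
have -> : d = gcdn d m * (d %/ gcdn d m) by rewrite mulnC divnK ?dvdn_gcdl.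
apply: allpairs_f; rewrite -dvdn_divisors ?dvdn_gcdr //.
have cop : coprime (d %/ gcdn d m) (m %/ gcdn d m).
  by rewrite /coprime -(eqn_pmul2r g0) mul1n muln_gcdl !divnK ?dvdn_gcdl ?dvdn_gcdr.
rewrite -(Gauss_dvdr n cop) -(dvdn_pmul2r g0) divnK ?dvdn_gcdl //.
by rewrite mulnAC divnK ?dvdn_gcdr.
Qed.

(** Coprimality gives [gcdn (x * y) m = x] for [x %| m] and [y %| n], so multiplication is injective
    on pairs of divisors. *)
Lemma size_divisors_coprimeM m n : 0 < m -> 0 < n -> coprime m n ->
  size (divisors m) * size (divisors n) <= size (divisors (m * n)).
Proof.
move=> m0 n0 cop; rewrite -(size_allpairs muln); apply: uniq_leq_size.
  apply: allpairs_uniq; rewrite ?divisors_uniq // => u v.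
  move=> /allpairsP[[d e] [/= md ne ->]] /allpairsP[[d' e'] [/= md' ne' ->]] /= eq_de.
  move: md ne md' ne'; rewrite -!dvdn_divisors // => md ne md' ne'.
  have gcdE x y : x %| m -> y %| n -> gcdn (x * y) m = x.
    move=> xm yn; rewrite gcdnC Gauss_gcdl; first exact/gcdn_idPr.
    exact: coprime_dvdr cop.
  have edd : d = d' by rewrite -(gcdE d e) // eq_de gcdE.
  congr (_, _) => //; move/eqP: eq_de; rewrite edd eqn_pmul2l; first by move/eqP.
  exact: dvdn_gt0 md'.
move=> _ /allpairsP[[d e] [/= md ne ->]].
by rewrite -dvdn_divisors ?muln_gt0 ?m0 // dvdn_mul // dvdn_divisors.
Qed.

Lemma size_divisors_le n : 0 < n -> size (divisors n) <= n.
Proof.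
move=> n0; rewrite -[leqRHS](size_iota 1 n).
apply: uniq_leq_size; first exact: divisors_uniq.
move=> d; rewrite -dvdn_divisors // mem_iota => dn.
by rewrite (dvdn_gt0 n0) // add1n ltnS dvdn_leq.
Qed.

Lemma size_divisors_pfactor p a : prime p -> size (divisors (p ^ a)) <= a.+1.
Proof.
move=> pr; rewrite -(size_iota 0 a.+1) -(size_map (expn p) (iota 0 a.+1)).
apply: uniq_leq_size; first exact: divisors_uniq.
move=> d; rewrite -dvdn_divisors ?expn_gt0 ?prime_gt0 // => /dvdn_pfactor-/(_ pr)[b ba ->].
by rewrite map_f // mem_iota.
Qed.

Lemma size_divisors_prod n : 0 < n ->
  size (divisors n) <= \prod_(p <- primes n) (logn p n).+1.
Proof.
move=> n0; rewrite [X in divisors X]prod_prime_decomp // prime_decompE big_map.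
rewrite big_seq [leqRHS]big_seq.
elim/big_rec2: _ => [|p a b]; first by [].
rewrite mem_primes => /andP[pr _] le; apply: leq_trans (size_divisorsM _ _) _.
by rewrite leq_mul ?size_divisors_pfactor.
Qed.

(* The primes [p <= y] contribute at most [K] each; each of the [e] prime
   factors (with multiplicity) above [y] contributes at most [2]. *)
Lemma size_divisors_split n y K : 0 < n -> n < 2 ^ K ->
  exists e, size (divisors n) <= K ^ y * 2 ^ e /\ y ^ e <= n.
Proof.
move=> n0 ltK; exists (\sum_(p <- primes n | y < p) logn p n).
have K0 : 0 < K by case: K ltK => //; rewrite expn0 ltnS leqNgt n0.
split.
  apply: leq_trans (size_divisors_prod n0) _.
  rewrite (bigID (fun p => y < p)) /= mulnC leq_mul //.
    rewrite -[X in _ <= K ^ X](size_iota 1 y).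
    apply: (@leq_trans (\prod_(p <- primes n | ~~ (y < p)) K)).
      rewrite big_seq_cond [leqRHS]big_seq_cond; apply: leq_prod => p /andP[].
      rewrite mem_primes => /and3P[pr _ _] _.
      (* The exponent of [p] is below [K] because [2 ^ logn p n <= p ^ logn p n <= n < 2 ^ K]. *)
      rewrite -(ltn_exp2l _ _ (isT : 1 < 2)); apply: leq_ltn_trans ltK.
      apply: leq_trans (dvdn_leq n0 (pfactor_dvdnn p n)).
      by have [->//|a0] := posnP (logn p n); rewrite leq_exp2r ?prime_gt1.
    rewrite big_const_seq iter_muln_1 leq_pexp2l // -size_filter.
    apply: uniq_leq_size; first by rewrite filter_uniq ?primes_uniq.
    move=> p; rewrite mem_filter mem_iota mem_primes => /andP[le /andP[pr _]].
    by rewrite prime_gt0 // add1n ltnS leqNgt.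
  by rewrite expn_sum; apply: leq_prod => p _; apply: ltn_expl.
rewrite expn_sum.
have Dn : n = \prod_(p <- primes n) p ^ logn p n.
  by rewrite [LHS]prod_prime_decomp // prime_decompE big_map.
rewrite [leqRHS]Dn [leqRHS](bigID (fun p => y < p)) /=.
apply: leq_trans (leq_pmulr _ _).
  apply: leq_prod => p yp.
  by have [->//|a0] := posnP (logn p n); rewrite leq_exp2r ?(ltnW yp).
rewrite big_seq_cond; apply: prodn_cond_gt0 => p /andP[].
by rewrite mem_primes => /andP[pr _] _; rewrite expn_gt0 prime_gt0.
Qed.

(** * Cancellation in quotients of reduced fractions *)

Lemma size_allpairs_dep_le (S R : Type) (T : S -> Type) (f : forall x, T x -> R)
    (s : seq S) (t : forall x, seq (T x)) c :
  (forall x, size (t x) <= c) ->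
  size [seq f x y | x <- s, y <- t x] <= size s * c.
Proof.
by move=> le; rewrite size_allpairs_dep; elim: s => //= x s IH; rewrite mulSn leq_add.
Qed.

(** After division by [g = gcdn a b] and [h = gcdn a' b'], each cofactor of the first product is
    coprime to both cofactors of the second, so nothing else cancels. *)
Lemma gcdn_cross a a' b b' : 0 < a -> 0 < a' ->
  coprime a a' -> coprime b b' ->
  gcdn (a * b') (a' * b) = gcdn a b * gcdn a' b'.
Proof.
move=> a0 a'0 cop_a cop_b.
set g := gcdn a b; set h := gcdn a' b'.
have g0 : 0 < g by rewrite gcdn_gt0 a0.
have h0 : 0 < h by rewrite gcdn_gt0 a'0.
have [ga gb] : g %| a /\ g %| b by rewrite dvdn_gcdl dvdn_gcdr.
have [ha hb] : h %| a' /\ h %| b' by rewrite dvdn_gcdl dvdn_gcdr.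
have cop1 : coprime (a %/ g) (b %/ g).
  by rewrite /coprime -(eqn_pmul2r g0) mul1n muln_gcdl !divnK.
have cop2 : coprime (a' %/ h) (b' %/ h).
  by rewrite /coprime -(eqn_pmul2r h0) mul1n muln_gcdl !divnK.
have cop : coprime ((a %/ g) * (b' %/ h)) ((a' %/ h) * (b %/ g)).
  rewrite coprimeMl !coprimeMr cop1 (coprime_sym (b' %/ h) (a' %/ h)) cop2 /= andbT.
  apply/andP; split.
    by apply: (coprime_dvdl (dvdn_div ga)); apply: (coprime_dvdr (dvdn_div ha)).
  rewrite coprime_sym.
  by apply: (coprime_dvdl (dvdn_div gb)); apply: (coprime_dvdr (dvdn_div hb)).
rewrite -(divnK ga) -(divnK gb) -(divnK ha) -(divnK hb) in cop *.
rewrite mulnACA [X in gcdn _ X]mulnACA (mulnC h g) -muln_gcdl.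
by move/eqP: cop; rewrite !divnK // => ->; rewrite mul1n.
Qed.

Definition num (x : rat) : nat := `|numq x|%N.
Definition den (x : rat) : nat := `|denq x|%N.

(** Integer form of [inF]. The representation need not be reduced; by [boxedP] the reduced one fits
    the same box. *)
Definition boxed N N' (x : rat) := exists q q',
  [/\ 0 < q <= N, 0 < q' <= N' & x = (q%:R / q'%:R)%R].

Lemma den_gt0 x : 0 < den x.
Proof. by rewrite absz_gt0 denq_neq0. Qed.

Lemma coprime_num_den x : coprime (num x) (den x).
Proof. exact: coprime_num_den. Qed.

Lemma num_den_coprime p q : 0 < q -> coprime p q ->
  num (p%:R / q%:R) = p /\ den (p%:R / q%:R) = q.
Proof.
move=> q0 cop; rewrite /num /den !pmulrn coprimeq_num // coprimeq_den //.
by case: q q0 cop => // q _ _; rewrite gtr0_sg // mul1r.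
Qed.

Lemma num_den_div p q : 0 < q ->
  num (p%:R / q%:R) * gcdn p q = p /\ den (p%:R / q%:R) * gcdn p q = q.
Proof.
move=> q0; have g0 : 0 < gcdn p q by rewrite gcdn_gt0 q0 orbT.
have [gp gq] : gcdn p q %| p /\ gcdn p q %| q by rewrite dvdn_gcdl dvdn_gcdr.
have E : (p%:R / q%:R = (p %/ gcdn p q)%:R / (q %/ gcdn p q)%:R :> rat)%R.
  rewrite -[in LHS](divnK gp) -[in X in (_ / X)%R = _](divnK gq).
  by rewrite !natrM invfM mulrACA divff ?mulr1 // pnatr_eq0 -lt0n.
rewrite E; have [||-> ->] := @num_den_coprime (p %/ gcdn p q) (q %/ gcdn p q).
- by rewrite divn_gt0 // dvdn_leq.
- by rewrite /coprime -(eqn_pmul2r g0) mul1n muln_gcdl !divnK.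
by rewrite !divnK.
Qed.

Lemma boxedP N N' x : boxed N N' x ->
  [/\ 0 < num x <= N, den x <= N' & x = ((num x)%:R / (den x)%:R)%R].
Proof.
move=> [p [q [/andP[p0 pN] /andP[q0 qN] ->]]].
have [Ep Eq] := num_den_div p q0.
have n0 : 0 < num (p%:R / q%:R) by move: p0; rewrite -{1}Ep muln_gt0 => /andP[].
split.
- by rewrite n0 (leq_trans _ pN) // -{2}Ep leq_pmulr // gcdn_gt0 p0.
- by rewrite (leq_trans _ qN) // -{2}Eq leq_pmulr // gcdn_gt0 p0.
have g0 : 0 < gcdn p q by rewrite gcdn_gt0 p0.
move: (num _) (den _) (gcdn p q) g0 Ep Eq => n d g g0 <- <-.
by rewrite !natrM invfM mulrACA divff ?mulr1 // pnatr_eq0 -lt0n.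
Qed.

(** The factor [m] lost when [a / b] is reduced, as [quotient_cancel] shows. *)
Definition common (a b : rat) := gcdn (num a) (num b) * gcdn (den a) (den b).

Lemma quotient_cancel N1 N1' N N' a b : boxed N1 N1' a -> boxed N N' b ->
  num (a / b)%R * common a b = num a * den b /\
  den (a / b)%R * common a b = den a * num b.
Proof.
move=> /boxedP[/andP[na0 _] _ Ea] /boxedP[/andP[nb0 _] _ Eb].
have E : (a / b = (num a * den b)%:R / (den a * num b)%:R)%R.
  by rewrite {1}Ea {1}Eb invf_div mulf_div !natrM.
rewrite /common -gcdn_cross ?den_gt0 ?coprime_num_den //.
by rewrite E; apply: num_den_div; rewrite muln_gt0 den_gt0.
Qed.

(** * Counting pairs by the size of the cancelled factor *)

(** A pair is determined by [a / b] and [a]. Given [r = a / b] and the cancelled factor [m], [num a]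
    divides [num r * m] and [den a] divides [den r * m], both at most [X]; this leaves [T * T]
    choices of [a] for each of at most [M] values of [m]. *)
Lemma few_cancellation X N1 N1' N N' M T (A B S : seq rat) :
  (forall n, 0 < n <= X -> size (divisors n) <= T) ->
  N1 * N' <= X -> N1' * N <= X ->
  uniq A -> uniq B ->
  (forall a, a \in A -> boxed N1 N1' a) ->
  (forall b, b \in B -> boxed N N' b) ->
  (forall a b, a \in A -> b \in B -> (a / b)%R \in S) ->
  size [seq ab <- [seq (a, b) | a <- A, b <- B] | common ab.1 ab.2 <= M]
    <= size S * (M * (T * T)).
Proof.
move=> leT leX1 leX2 uA uB bA bB inS.
(* The empty default outside the range makes the bound [T * T] hold for every [r] and [m], including
   those that come from no pair. *)
pose L (u v : nat) := if [&& 0 < u <= X & 0 < v <= X] then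
  [seq (d, e) | d <- divisors u, e <- divisors v] else [::].
pose K := [seq (r, me) | r <- S, me <-
  [seq (m, de) | m <- iota 1 M, de <- L (num r * m) (den r * m)]].
have leK : size K <= size S * (M * (T * T)).
  apply: size_allpairs_dep_le => r; rewrite -[in leqRHS](size_iota 1 M).
  apply: size_allpairs_dep_le => m; rewrite /L; case: ifP => // /andP[u v].
  by rewrite size_allpairs leq_mul ?leT.
apply: leq_trans leK.
pose phi ab := (ab.1 / ab.2, (common ab.1 ab.2, (num ab.1, den ab.1)))%R.
rewrite -(size_map phi); apply: uniq_leq_size.
  rewrite map_inj_in_uniq.
    by rewrite filter_uniq // allpairs_uniq // => -[? ?] [? ?] _ _ /= [-> ->].
  move=> u v; rewrite !mem_filter.
  move=> /andP[_ /allpairsP[[a b] [/= aA bB' ->]]] /andP[_ /allpairsP[[a' b'] [/= aA' bB'' ->]]].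
  move=> [/= Eq _ En Ed].
  have [/andP[na0 _] _ Ea] := boxedP (bA _ aA).
  have [_ _ Ea'] := boxedP (bA _ aA').
  have Eaa : a = a' by rewrite Ea Ea' En Ed.
  congr (_, _) => //; apply: invr_inj; apply: (@mulfI _ a); last by rewrite Eq Eaa.
  by rewrite -numq_eq0 -absz_gt0.
move=> _ /mapP[ab + ->]; rewrite mem_filter => /andP[leM /allpairsP[[a b] [/= aA bB' E]]].
rewrite {ab}E /= in leM *.
have [/andP[na0 naN] daN Ea] := boxedP (bA _ aA).
have [/andP[nb0 nbN] dbN Eb] := boxedP (bB _ bB').
have [E1 E2] := quotient_cancel (bA _ aA) (bB _ bB').
apply: allpairs_f_dep; first exact: inS.
apply: allpairs_f_dep.
  by rewrite mem_iota add1n ltnS leM muln_gt0 !gcdn_gt0 na0 den_gt0.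
rewrite E1 E2 /L !muln_gt0 na0 nb0 !den_gt0 /=.
rewrite (leq_trans (leq_mul naN dbN)) // (leq_trans (leq_mul daN nbN)) //=.
by apply: allpairs_f; rewrite -dvdn_divisors ?muln_gt0 ?na0 ?den_gt0 // dvdn_mulr.
Qed.

Lemma common_le N1 N1' a b : boxed N1 N1' a -> common a b <= N1 * N1'.
Proof.
move=> /boxedP[/andP[na0 naN] daN _]; apply: leq_mul.
  by apply: leq_trans naN; rewrite dvdn_leq // dvdn_gcdl.
by apply: leq_trans daN; rewrite dvdn_leq ?den_gt0 // dvdn_gcdl.
Qed.

Lemma boxed_scale N N' d d' a : boxed N N' a -> d %| num a -> d' %| den a ->
  boxed (N %/ d) (N' %/ d') (a * (d'%:R / d%:R)).
Proof.
move=> /boxedP[/andP[na0 naN] daN Ea] dn dd.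
have [d0 d'0] : 0 < d /\ 0 < d' by rewrite (dvdn_gt0 na0) // (dvdn_gt0 (den_gt0 a)).
exists (num a %/ d), (den a %/ d'); split.
- by rewrite divn_gt0 // dvdn_leq //= leq_div2r.
- by rewrite divn_gt0 // dvdn_leq ?den_gt0 //= leq_div2r.
have nz n : 0 < n -> (n%:R != 0 :> rat)%R by rewrite pnatr_eq0 -lt0n.
have Da : (a = (num a %/ d * d)%:R / (den a %/ d' * d')%:R)%R by rewrite !divnK.
rewrite {1}Da !natrM; have nz1 := nz _ (den_gt0 a).
have nz2 : ((den a %/ d')%:R != 0 :> rat)%R by rewrite nz // divn_gt0 // dvdn_leq ?den_gt0.
by field; rewrite nz2 !nz.
Qed.

(* Given the claim for each fraction divisible by [d / d'] with [d * d' > M]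
   (rescaled, these have height at most [1 / M] times as large), a fixed [b]
   sees at most [T] such pairs [(d, d')] among the divisors of [b]. *)
Lemma many_cancellation X N N' M T C (A B : seq rat) b :
  (forall n, 0 < n <= X -> size (divisors n) <= T) ->
  N * N' <= X -> boxed N N' b ->
  (forall d d', 0 < d -> 0 < d' -> M < d * d' ->
     count (fun a => (d %| num a) && (d' %| den a)) A * size B <= C) ->
  count (fun a => M < common a b) A * size B <= T * C.
Proof.
move=> leT leX bB leC.
have [/andP[nb0 nbN] dbN _] := boxedP bB.
pose D := [seq (d, d') | d <- divisors (num b), d' <- divisors (den b)].
(* Since [num b] and [den b] are coprime, the pairs are no more numerous than the divisors of
   [num b * den b]: the cost is [T], not [T * T]. *)
have leD : size D <= T.
  rewrite size_allpairs; apply: leq_trans (leT (num b * den b) _).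
    by rewrite size_divisors_coprimeM ?den_gt0 ?coprime_num_den.
  by rewrite muln_gt0 nb0 den_gt0 (leq_trans (leq_mul nbN dbN)).
apply: (@leq_trans (\sum_(dd <- D) C)); last first.
  by rewrite big_const_seq count_predT iter_addn_0 mulnC leq_mul2r leD orbT.
apply: (@leq_trans (\sum_(dd <- D) count (fun a =>
    [&& M < dd.1 * dd.2, dd.1 %| num a & dd.2 %| den a]) A * size B)); last first.
  rewrite big_seq [leqRHS]big_seq.
  apply: leq_sum => _ /allpairsP[[d d'] [/= dn dd ->]] /=.
  move: dn dd; rewrite -!dvdn_divisors ?den_gt0 // => dn dd.
  have [Mlt|_] := boolP (M < d * d'); last by rewrite count_pred0 mul0n.
  by apply: leC Mlt; [exact: dvdn_gt0 nb0 dn | exact: dvdn_gt0 (den_gt0 b) dd].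
rewrite -big_distrl /= leq_mul2r; apply/orP; right.
under eq_bigr do rewrite -sum1_count big_mkcond.
rewrite exchange_big /= -sum1_count big_mkcond; apply: leq_sum => a _ /=.
case: ifP => // Mlt.
(* Each [a] with large cancellation is counted at least once, by the pair of gcds whose product is
   [common a b]. *)
have inD : (gcdn (num a) (num b), gcdn (den a) (den b)) \in D.
  by apply: allpairs_f; rewrite -dvdn_divisors ?den_gt0 // dvdn_gcdr.
by rewrite (big_rem _ inD) /= !dvdn_gcdl !andbT -[_ * _]/(common a b) Mlt.
Qed.

(** Induction on [j]: only the box of [A] shrinks, while [B] keeps its box. [S] is any list
    containing the quotients, so it can be rescaled along with a part of [A]. Each step adds the
    pairs with little cancellation and multiplies the previous bound by [T]. *)
Lemma quotient_bound_boxed X N N' M T : 0 < T -> N * N' <= X ->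
  (forall n, 0 < n <= X -> size (divisors n) <= T) ->
  forall j N1 N1' (A B S : seq rat),
  0 < M -> N1 <= N -> N1' <= N' -> N1 * N1' <= M ^ j ->
  uniq A -> uniq B ->
  (forall a, a \in A -> boxed N1 N1' a) ->
  (forall b, b \in B -> boxed N N' b) ->
  (forall a b, a \in A -> b \in B -> (a / b)%R \in S) ->
  size A * size B <= size S * (j.+1 * M * T ^ j.+2).
Proof.
move=> T0 leX leT; elim=> [|j IH] N1 N1' A B S M0 leN leN' lej uA uB bA bB inS;
  rewrite -(size_allpairs pair) -(count_predC (fun ab => common ab.1 ab.2 <= M)) -size_filter;
  have few := few_cancellation M leT (leq_trans (leq_mul leN (leqnn N')) leX)
    (leq_trans (leq_mul leN' (leqnn N)) (leq_trans (eq_leq (mulnC _ _)) leX))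
    uA uB bA bB inS.
  (* For [j = 0] the sides of the box of [A] have product at most 1, so no pair cancels more than
     [M]. *)
  rewrite [X in _ + X](_ : _ = 0) ?addn0 ?mul1n //.
  apply/eqP; rewrite -leqn0 leqNgt -has_count.
  apply/hasPn => _ /allpairsP[[a b] [/= aA _ ->]].
  by rewrite /= negbK (leq_trans (common_le _ (bA _ aA))) // (leq_trans lej) // expn0.
have [B0|B0] := posnP (size B).
  by rewrite size_filter count_predC size_allpairs B0 muln0.
set C := size S * (j.+1 * M * T ^ j.+2).
suff bad : count (predC (fun ab => common ab.1 ab.2 <= M)) [seq (a, b) | a <- A, b <- B]
    <= T * C.
  apply: leq_trans (leq_add few bad) _.
  rewrite /C [X in _ + X]mulnCA -mulnDr leq_mul2l; apply/orP; right.
  rewrite [X in _ + X]mulnCA -expnS [in leqRHS]mulSn mulnDl leq_add2r leq_mul2l.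
  by rewrite mulnn leq_pexp2l ?orbT.
(* The induction hypothesis bounds a part of [A] times all of [B]. With the goal multiplied by
   [size B], each [b] may therefore contribute [T * C]. *)
rewrite -(leq_pmul2r B0).
have -> : count (predC (fun ab => common ab.1 ab.2 <= M)) [seq (a, b) | a <- A, b <- B]
   = \sum_(b <- B) count (fun a => M < common a b) A.
  rewrite -sum1_count big_mkcond big_allpairs exchange_big /=; apply: eq_bigr => b _.
  by rewrite -sum1_count [RHS]big_mkcond; apply: eq_bigr => a _; rewrite ltnNge.
rewrite big_distrl /= big_seq.
apply: (@leq_trans (\sum_(b <- B | b \in B) T * C)); last first.
  by rewrite -big_seq big_const_seq count_predT iter_addn_0.
apply: leq_sum => b bB'; apply: (many_cancellation leT leX (bB _ bB')).
move=> d d' d0 d'0 Mlt; rewrite -size_filter.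
set c : rat := (d'%:R / d%:R)%R.
have injc : injective (fun x : rat => (x * c)%R).
  by apply: mulIf; rewrite mulf_neq0 ?invr_eq0 ?pnatr_eq0 -?lt0n.
rewrite -(size_map (fun x => (x * c)%R)) /C -(size_map (fun x => (x * c)%R) S).
apply: (IH (N1 %/ d) (N1' %/ d')) => //.
- exact: leq_trans (leq_div _ _) leN.
- exact: leq_trans (leq_div _ _) leN'.
(* As [M < d * d'], the rescaled box loses a factor [M], hence one power of [M]. *)
- rewrite -(leq_pmul2r M0) -expnSr; apply: leq_trans lej.
  apply: leq_trans (leq_mul (leqnn _) (ltnW Mlt)) _.
  by rewrite mulnACA leq_mul ?leq_divM.
- by rewrite map_inj_uniq // filter_uniq.
- move=> _ /mapP[a + ->]; rewrite mem_filter => /andP[/andP[dn dd] aA].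
  exact: boxed_scale (bA _ aA) dn dd.
- move=> _ b' /mapP[a + ->] bB''; rewrite mem_filter => /andP[_ aA].
  by rewrite mulrAC; apply: (map_f (fun x => (x * c)%R)); apply: inS.
Qed.

(** * Real bounds: the divisor estimate and the choice of parameters *)

Local Open Scope classical_set_scope.
Local Open Scope ring_scope.

Lemma quotient_bound (R : realType) (Q Q' : R) (A B : {fset rat}) (M T k : nat) :
  1 <= Q -> 1 <= Q' -> (0 < M)%N -> Q * Q' <= M%:R ^+ k ->
  (forall n, (0 < n)%N -> n%:R <= Q * Q' -> (size (divisors n) <= T)%N) ->
  (forall a, a \in A -> inF Q Q' a) ->
  (forall b, b \in B -> inF Q Q' b) ->
  (#|` A| * #|` B| <= #|` fsdiv A B| * (k.+1 * M * T ^ k.+2))%N.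
Proof.
move=> Q1 Q'1 M0 leM leT inA inB.
pose N := Num.trunc Q; pose N' := Num.trunc Q'.
have Q0 : 0 <= Q by lra.
have Q'0 : 0 <= Q' by lra.
have leNN : (N * N')%:R <= Q * Q' by rewrite natrM ler_pM // truncn_le.
have boxedF x : inF Q Q' x -> boxed N N' x.
  move=> [q [q' [q0 qQ q'0 qQ' ->]]]; exists q, q'; split=> //.
    by rewrite q0 truncn_ge_nat.
  by rewrite q'0 truncn_ge_nat.
apply: (@quotient_bound_boxed (N * N') N N' M T _ _ _ k N N') => //; rewrite ?fset_uniq //.
(* Positivity of [T] comes from the single divisor of 1. *)
- by apply: leq_trans (leT 1%N isT _); rewrite // -(mulr1 1) ler_pM.
- by move=> n /andP[n0 nX]; apply: leT => //; apply: le_trans leNN; rewrite ler_nat.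
- by rewrite -(ler_nat R) natrX (le_trans leNN).
- by move=> a /inA/boxedF.
- by move=> b /inB/boxedF.
- by move=> a b aA bB; apply/imfset2P; exists a => //; exists b.
Qed.

Lemma ln2_bounds (R : realType) : 1 / 2 <= ln (2 : R) <= 1.
Proof.
apply/andP; split; last by rewrite -[2%:R]/(1 + 1) le_ln1Dx //; lra.
rewrite -lerN2 -lnV ?posrE //.
by have := @le_ln1Dx R (- (1 / 2)); rewrite (_ : 1 + _ = 2^-1); [apply; lra | lra].
Qed.

(** Wigert's bound, with [x = expR (expR l)] and [L = ln x]. Cut the primes at [y], about
    [L ^ (1 - d)]: those up to [y] contribute [y * ln K], which is negligible against [L / l], and
    at most [L / ln y] prime factors lie above [y], each contributing [ln 2]. *)
Lemma divisor_bound (R : realType) (eta : R) : 0 < eta ->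
  exists l0, forall l, l0 <= l -> forall n : nat, (0 < n)%N ->
    n%:R <= expR (expR l) ->
    (size (divisors n))%:R <= expR ((ln 2 + eta) * (expR l / l)).
Proof.
move=> eta0; pose d := Num.min (eta / 5) (1 / 4).
have d0 : 0 < d by rewrite lt_min; apply/andP; split; lra.
have d_eta : 5 * d <= eta by have : d <= eta / 5 by [rewrite ge_min lexx]; lra.
have d4 : d <= 1 / 4 by rewrite ge_min lexx orbT.
have /andP[ln2_ge ln2_le] := ln2_bounds R.
(* The summands ensure [2 <= l], [1 <= d * l] and [12 <= d ^+ 4 * l] respectively. *)
exists (2 + d^-1 + 12 / d ^+ 4) => l l_ge n n0 nx.
have dV : 0 < d^-1 by rewrite invr_gt0.
have d4V : 0 < 12 / d ^+ 4 by rewrite divr_gt0 // exprn_gt0.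
have l2 : 2 <= l by lra.
have dl : 1 <= d * l by rewrite -(mulfV (lt0r_neq0 d0)) ler_pM2l //; lra.
have d4l : 12 <= d ^+ 4 * l.
  by rewrite mulrC -ler_pdivrMr ?exprn_gt0 //; lra.
set L := expR l in nx *.
have L_ge : 1 <= L by rewrite /L -[leLHS]expR0 ler_expR; lra.
(* Two nearby powers of [L]: the gap [2 * E <= F] leaves room to round [F] down to an integer [y]
   with [E <= y <= F]. *)
set E := expR ((1 - 2 * d) * l); set F := expR ((1 - d) * l).
have E1 : 1 <= E by rewrite /E -[leLHS]expR0 ler_expR mulr_ge0 //; lra.
have FE : 2 * E <= F.
  have -> : F = expR (d * l) * E by rewrite -expRD; congr expR; ring.
  rewrite ler_pM2r; last by lra.
  by have := expR_ge1Dx (d * l); lra.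
pose y := Num.trunc F; pose K := (trunc_log 2 n).+1.
have yE : E <= y%:R.
  have := truncnS_gt F; rewrite -natr1 -/y; lra.
have yF : y%:R <= F by rewrite truncn_le; lra.
have [e [lediv ye]] := @size_divisors_split n y K n0 (trunc_log_ltn n (isT : 1 < 2)%N).
have n_gt0 : 0 < n%:R :> R by rewrite ltr0n.
have lnn : ln n%:R <= L by rewrite -[leRHS]expRK ler_ln ?posrE ?expR_gt0.
have K_le : K%:R <= 3 * L.
  have : (2 ^ trunc_log 2 n)%:R <= n%:R :> R by rewrite ler_nat trunc_logP.
  rewrite natrX -ler_ln ?posrE ?exprn_gt0 // lnXn // -[X in X <= _]mulr_natr => tn; rewrite /K -natr1.
  move: (trunc_log 2 n)%:R (ler0n R (trunc_log 2 n)) tn => t t0 tn.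
  have : t / 2 <= ln 2 * t by nra.
  lra.
have lnK_le : ln K%:R <= 2 + l.
  apply: (@le_trans _ _ (ln (3 * L))).
    by rewrite ler_ln ?posrE ?ltr0n // mulr_gt0 //; lra.
  rewrite lnM ?posrE // ?expR_gt0 // expRK lerD2r.
  by have := @le_ln1Dx R 2; rewrite (_ : 1 + 2 = 3); [apply; lra | lra].
have e_le : e%:R * ((1 - 2 * d) * l) <= L.
  apply: le_trans lnn; rewrite -[X in _ * X]expRK -/E.
  rewrite mulr_natl -lnXn; last by lra.
  rewrite ler_ln ?posrE ?exprn_gt0 //; last by lra.
  apply: (@le_trans _ _ (y%:R ^+ e)); last by rewrite -natrX ler_nat.
  by rewrite lerXn2r ?nnegrE //; lra.
have y_le : y%:R * ln K%:R <= d * (L / l).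
  have lnK0 : 0 <= ln K%:R :> R by rewrite ln_ge0 // ler1n.
  apply: (@le_trans _ _ (F * (2 + l))); first by rewrite ler_pM.
  have -> : L = F * expR (d * l) by rewrite -expRD; congr expR; ring.
  rewrite mulrCA -mulrA ler_pM2l ?expR_gt0 // mulrCA mulrA ler_pdivlMr; last by lra.
  (* The cubic term of the exponential series suffices to beat [l * (2 + l)]. *)
  have G : (d * l) ^+ 3 / 6 <= expR (d * l).
    by have := @expR_ge1Dxn _ (d * l) 2; rewrite (_ : (3`!)%N = 6%N) //; lra.
  apply: (@le_trans _ _ (d * ((d * l) ^+ 3 / 6))); last by rewrite ler_pM2l.
  have -> : d * ((d * l) ^+ 3 / 6) = (d ^+ 4 * l) * l ^+ 2 / 6 by field.
  nra.
have div_gt0 : 0 < (size (divisors n))%:R :> R by rewrite ltr0n size_divisors_gt0.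
rewrite -[leLHS]lnK ?posrE // ler_expR.
apply: (@le_trans _ _ (y%:R * ln K%:R + e%:R * ln 2)).
  rewrite !mulr_natl -!lnXn // -lnM ?posrE ?exprn_gt0 //.
  rewrite ler_ln ?posrE ?mulr_gt0 ?exprn_gt0 //.
  by rewrite -!natrX -natrM ler_nat.
have e_le' : e%:R * ln 2 <= (ln 2 + 4 * d) * (L / l).
  have c0 : 0 < (1 - 2 * d) * l by rewrite mulr_gt0 //; lra.
  have e_le1 : e%:R <= L / l / (1 - 2 * d).
    by rewrite -mulrA -invfM (mulrC l) ler_pdivlMr.
  have Ll : 0 < L / l by rewrite divr_gt0 //; lra.
  apply: (@le_trans _ _ (L / l / (1 - 2 * d) * ln 2)); first by rewrite ler_pM2r //; lra.
  have -> : L / l / (1 - 2 * d) * ln 2 = ln 2 / (1 - 2 * d) * (L / l) by ring.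
  rewrite ler_pM2r // ler_pdivrMr; last by lra.
  nra.
have Ll : 0 < L / l by rewrite divr_gt0 //; lra.
have : 5 * d * (L / l) <= eta * (L / l) by rewrite ler_pM2r.
lra.
Qed.

(* [k] steps, each dividing the height by [M], about the [k]-th root of [x], and
   losing a factor [T], about [expR (ln 2 * (ln x / ln (ln x)))]: the total loss
   [M * T ^ k] is minimized at [k = sqrt (ln (ln x) / ln 2)]. *)
Lemma optimal_parameters (R : realType) (eta : R) : 0 < eta ->
  exists l0, forall l, l0 <= l -> exists M T k : nat,
  [/\ (0 < M)%N, expR (expR l) <= M%:R ^+ k,
      (forall n, (0 < n)%N -> n%:R <= expR (expR l) -> (size (divisors n) <= T)%N)
    & (k.+1 * M * T ^ k.+2)%:R
        <= expR ((2 * Num.sqrt (ln 2) + eta) * (expR l / Num.sqrt l))].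
Proof.
move=> eta0; set c := Num.sqrt (ln 2).
have /andP[ln2_ge ln2_le] := ln2_bounds R.
have c0 : 0 < c by rewrite sqrtr_gt0; lra.
have cc : ln 2 = c ^+ 2 by rewrite sqr_sqrtr //; lra.
have cV0 : 0 < c^-1 by rewrite invr_gt0.
pose eta' := c * eta / 3.
have eta'0 : 0 < eta' by rewrite divr_gt0 // mulr_gt0.
have [ld divP] := divisor_bound eta'0.
(* The error [eta] is split in thirds: [eta'] gives one through [D * (s / c)], [S1 <= s] makes
   [D * 3] fit the second, and [S2 <= s] makes [s / c + 2] fit the third. *)
pose S1 := 9 * (c ^+ 2 + eta') / eta; pose S2 := 6 * (c^-1 + 2) / eta.
have c20 : 0 < c ^+ 2 by rewrite exprn_gt0.
have S10 : 0 < S1 by rewrite divr_gt0 // mulr_gt0 //; lra.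
have S20 : 0 < S2 by rewrite divr_gt0 // mulr_gt0 //; lra.
have S1E : S1 * eta = 9 * (c ^+ 2 + eta') by rewrite divfK ?lt0r_neq0.
have S2E : S2 * eta = 6 * (c^-1 + 2) by rewrite divfK ?lt0r_neq0.
clearbody S1 S2.
exists (Num.max ld ((1 + S1 + S2) ^+ 2)) => l; rewrite ge_max => /andP[ld_le l_ge].
set s := Num.sqrt l.
have sS : 1 + S1 + S2 <= s.
  rewrite -[leLHS]ger0_norm; last by lra.
  by rewrite -sqrtr_sqr ler_sqrt // (le_trans _ l_ge) // sqr_ge0.
have ss : l = s ^+ 2 by rewrite sqr_sqrtr // (le_trans _ l_ge) // sqr_ge0.
have [s1 S1_le S2_le] : [/\ 1 <= s, S1 <= s & S2 <= s] by split; lra.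
clear l_ge.
have s0 : 0 < s by lra.
set L := expR l.
have L0 : 0 < L by exact: expR_gt0.
have L_ge : s ^+ 4 / 2 <= L.
  have := @expR_ge1Dxn _ l 1; rewrite (_ : (2`!)%N = 2%N) // ss -exprM /= => H.
  have : 0 <= s ^+ 2 by rewrite sqr_ge0.
  by rewrite /L ss; move/H; lra.
(* The value [s / c] balances [L / k] against [k * ln 2 * (L / l)], each being then [c * (L / s)].
   Rounding up keeps [L / k] below that value and costs at most one further [D]. *)
pose k := (Num.trunc (s / c)).+1.
have sc0 : 0 < s / c by rewrite divr_gt0.
have k_gt : s / c < k%:R by exact: truncnS_gt.
have k_le : k%:R <= s / c + 1 by rewrite /k -natr1 lerD2r truncn_le ltW.
have k0 : 0 < k%:R :> R by rewrite ltr0n.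
pose M := (Num.trunc (expR (L / k%:R))).+1.
pose D := (ln 2 + eta') * (L / l).
have D0 : 0 < D by rewrite mulr_gt0 // ?divr_gt0 //; nra.
exists M, (Num.trunc (expR D)), k; split => //.
- rewrite -[L in leLHS](divfK (lt0r_neq0 k0)) expRM_natr.
  by rewrite lerXn2r ?nnegrE ?expR_ge0 // ltW // truncnS_gt.
- by move=> n n0 nx; rewrite truncn_ge_nat ?expR_ge0 //; apply: divP.
have k_exp : k.+1%:R <= expR (k%:R : R).
  by rewrite -natr1 addrC expR_ge1Dx.
(* The rounding of [M] is absorbed by a factor [expR 1], since [u + 1 <= 2 * u] for [1 <= u]. *)
have M_exp : M%:R <= expR (1 + L / k%:R).
  rewrite expRD /M -natr1.
  have : (Num.trunc (expR (L / k%:R)))%:R <= expR (L / k%:R) by rewrite truncn_le expR_ge0.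
  have e2 : 2 <= expR 1 :> R by have := @expR_ge1Dx R 1; lra.
  have : 1 <= expR (L / k%:R) by rewrite -[leLHS]expR0 ler_expR divr_ge0 // ltW.
  by move: (expR (L / k%:R)) => u; nra.
have T_exp : (Num.trunc (expR D))%:R ^+ k.+2 <= expR (D * k.+2%:R).
  by rewrite expRM_natr lerXn2r ?nnegrE ?expR_ge0 // truncn_le expR_ge0.
rewrite natrM natrX natrM.
apply: (@le_trans _ _ (expR (k%:R + (1 + L / k%:R) + D * k.+2%:R))).
  rewrite expRD expRD; apply: ler_pM T_exp; rewrite ?exprn_ge0 ?ler0n //.
  by rewrite ler_pM ?ler0n.
rewrite ler_expR -(natr1 k.+1) -(natr1 k).
set w := L / s.
have w0 : 0 < w by rewrite divr_gt0.
have Lk : L / k%:R <= c * w.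
  have -> : c * w = L / (s / c) by rewrite /w; field; rewrite !lt0r_neq0.
  by rewrite ler_pM2l // lef_pV2 ?posrE // ltW.
have Dk : D * k%:R <= D * (s / c + 1) by rewrite ler_pM2l.
have Dsc : D * (s / c) = (c + eta / 3) * w.
  by rewrite /D /w /eta' cc [in L / l]ss; field; rewrite !lt0r_neq0.
have D3 : D * 3 <= eta / 3 * w.
  have -> : D * 3 = 3 * (c ^+ 2 + eta') / s * w.
    by rewrite /D /w cc [in L / l]ss; field; rewrite !lt0r_neq0.
  rewrite ler_pM2r // ler_pdivrMr //.
  have : S1 * eta <= s * eta by rewrite ler_pM2r.
  rewrite S1E; move: (c ^+ 2 + eta') => u; clear; lra.
have low : s / c + 2 <= eta / 3 * w.
  have w_ge : s ^+ 3 / 2 <= w.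
    by rewrite /w ler_pdivlMr // (le_trans _ L_ge) // mulrAC -exprSr.
  have le_s : 6 * (c^-1 + 2) <= s * eta by rewrite -S2E ler_pM2r.
  have s2 : s <= s ^+ 2 by rewrite expr2 ler_peMl // ltW.
  have eta6 : c^-1 + 2 <= eta / 6 * s ^+ 2.
    apply: (@le_trans _ _ (eta / 6 * s)); last by rewrite ler_pM2l // divr_gt0.
    by move: le_s; clear; lra.
  apply: (@le_trans _ _ (s * (c^-1 + 2))); first by move: s1; clear; lra.
  apply: (@le_trans _ _ (s * (eta / 6 * s ^+ 2))); first by rewrite ler_pM2l.
  have -> : s * (eta / 6 * s ^+ 2) = eta / 3 * (s ^+ 3 / 2) by field.
  by rewrite ler_pM2l // divr_gt0.
move: k_le Lk Dk Dsc D3 low; move: (k%:R) (L / k%:R) (s / c) => x y z; clear; lra.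
Qed.

(** * The vanishing error function and the conclusion *)

Lemma quotient_bound_expR (R : realType) (m n C : nat) (Y : R) :
  (m <= n * C)%N -> C%:R <= expR Y -> m%:R * expR (- Y) <= n%:R.
Proof.
move=> mn CY; rewrite expRN ler_pdivrMr ?expR_gt0 //.
apply: (@le_trans _ _ (n * C)%:R); first by rewrite ler_nat.
by rewrite natrM ler_wpM2l.
Qed.

(** Turns a bound valid for each fixed [eta] and large [x] into one with a single function tending
    to 0, given that every [x > x0] admits some error. *)
Lemma vanishing_error (R : realType) (P : R -> R -> Prop) (x0 : R) :
  (forall x eta eta', eta <= eta' -> P x eta -> P x eta') ->
  (forall x, x0 < x -> exists eta, 0 <= eta /\ P x eta) ->
  (forall eta, 0 < eta -> exists x1, forall x, x1 <= x -> P x eta) ->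
  exists eps : R -> R,
    eps x @[x --> +oo] --> 0 /\ forall x, 0 < x -> x0 < x -> P x (eps x).
Proof.
move=> mono exP limP; pose E x := [set eta | 0 <= eta /\ P x eta].
have lbE x : lbound (E x) 0 by move=> eta [].
(* The infimum of the admissible errors need not be attained; by monotonicity, adding the vanishing
   positive term [x^-1] makes it admissible. *)
exists (fun x => inf (E x) + x^-1); split; last first.
  move=> x x_gt0 /exP exE.
  have xV0 : 0 < x^-1 by rewrite invr_gt0.
  have infE : has_inf (E x) by split; last exists 0.
  have [eta [_ Peta] /ltW le_eta] := inf_adherent xV0 infE.
  exact: mono le_eta Peta.
apply/cvgrPdist_le => /= e e0.
have e20 : 0 < e / 2 by rewrite divr_gt0.
have [x1 Px1] := limP (e / 2) e20.
near=> x.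
have x_gt : 2 / e <= x by near: x; apply: nbhs_pinfty_ge; rewrite num_real.
have x_gt0 : 0 < x by apply: lt_le_trans x_gt; rewrite divr_gt0.
have x1x : x1 <= x by near: x; apply: nbhs_pinfty_ge; rewrite num_real.
have Ee : E x (e / 2) by split; [rewrite divr_ge0 // ltW | exact: Px1].
have inf_le : inf (E x) <= e / 2 by apply: ge_inf => //; exists 0.
have inf_ge : 0 <= inf (E x) by apply: lb_le_inf => //; exists (e / 2).
have xV : x^-1 <= e / 2 by rewrite -[e / 2]invrK lef_pV2 ?posrE ?invr_gt0 ?divr_gt0 // invf_div.
have xV0 : 0 < x^-1 by rewrite invr_gt0.
rewrite sub0r normrN ger0_norm; lra.
Unshelve. all: by end_near.
Qed.

Theorem theorem1 (R : realType) :
  exists eps : R -> R,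
    eps x @[x --> +oo] --> 0 /\
    forall (Q Q' : R), 1 <= Q -> 1 <= Q' -> expR 1 < Q * Q' ->
    forall A B : {fset rat},
      (forall a, a \in A -> inF Q Q' a) ->
      (forall b, b \in B -> inF Q Q' b) ->
      (#|` A|%:R * #|` B|%:R
         * expR (- ((2 * Num.sqrt (ln 2) + eps (Q * Q'))
                    * (ln (Q * Q') / Num.sqrt (ln (ln (Q * Q'))))))
       <= (#|` fsdiv A B|%:R : R)).
Proof.
pose Y (x eta : R) := (2 * Num.sqrt (ln 2) + eta) * (ln x / Num.sqrt (ln (ln x))).
(* Quantifying over all [Q], [Q'] with product [x] makes the error depend on the product alone. *)
pose P (x eta : R) := forall Q Q' : R, 1 <= Q -> 1 <= Q' -> expR 1 < Q * Q' ->
  Q * Q' = x -> forall A B : {fset rat},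
  (forall a, a \in A -> inF Q Q' a) -> (forall b, b \in B -> inF Q Q' b) ->
  (#|` A| * #|` B|)%:R * expR (- Y x eta) <= #|` fsdiv A B|%:R.
have w0 x : expR 1 < x -> 0 < ln x / Num.sqrt (ln (ln x)).
  move=> x_gt; have x0 : 0 < x by apply: lt_trans x_gt; exact: expR_gt0.
  have lnx : 1 < ln x by rewrite -[ltLHS]expRK ltr_ln ?posrE ?expR_gt0.
  by rewrite divr_gt0 ?sqrtr_gt0; [| exact: lt_trans lnx | exact: ln_gt0].
have [|x e_lt|eta eta0|eps [eps0 epsP]] := @vanishing_error R P (expR 1).
- move=> x eta eta' le_eta Px Q Q' Q1 Q'1 e_lt Ex A B inA inB.
  apply: le_trans (Px Q Q' Q1 Q'1 e_lt Ex A B inA inB).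
  by rewrite ler_wpM2l // ler_expR lerN2 ler_pM2r ?lerD2l // w0 // -Ex.
(* A crude bound for every [x]: one step, [k = 1], with [T = M > x], gives a constant [C] that the
   error [ln C%:R / w] absorbs. *)
- pose M := (Num.trunc x).+1; pose C := (2 * M * M ^ 3)%N.
  pose w := ln x / Num.sqrt (ln (ln x)).
  have w_gt0 : 0 < w by exact: w0.
  have C1 : (0 < C)%N by rewrite !muln_gt0.
  exists (ln C%:R / w); split.
    by rewrite divr_ge0 ?ln_ge0 ?ler1n // ltW.
  move=> Q Q' Q1 Q'1 _ Ex A B inA inB.
  apply: (@quotient_bound_expR _ _ _ C).
    apply: (quotient_bound Q1 Q'1) => //.
      by rewrite expr1 Ex ltW // truncnS_gt.
    move=> n n0; rewrite Ex => nx; apply: leq_trans (size_divisors_le n0) _.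
    rewrite leqW // truncn_ge_nat // ltW //.
    by apply: lt_trans e_lt; exact: expR_gt0.
  rewrite -[leLHS]lnK ?posrE ?ltr0n // ler_expR /Y -/w mulrDl divfK ?lt0r_neq0 //.
  by rewrite lerDr; apply: mulr_ge0 (ltW w_gt0); rewrite mulr_ge0 ?sqrtr_ge0.
(* For large [x] the optimal parameters are taken at [l = ln (ln x)]. *)
- have [l0 l0P] := optimal_parameters eta0.
  exists (expR (expR l0)) => x x_ge Q Q' Q1 Q'1 e_lt Ex A B inA inB.
  have x0 : 0 < x by apply: lt_le_trans x_ge; exact: expR_gt0.
  have lnx : expR l0 <= ln x by rewrite -[leLHS]expRK ler_ln ?posrE ?expR_gt0.
  have lnx0 : 0 < ln x by apply: lt_le_trans lnx; exact: expR_gt0.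
  have lnlnx : l0 <= ln (ln x) by rewrite -[leLHS]expRK ler_ln ?posrE ?expR_gt0.
  have [M [T [k []]]] := l0P _ lnlnx.
  rewrite !lnK ?posrE // -Ex => M0 Mk leT leC.
  apply: quotient_bound_expR leC.
  exact: (quotient_bound Q1 Q'1 M0 Mk leT inA inB).
exists eps; split=> // Q Q' Q1 Q'1 e_lt A B inA inB.
rewrite -natrM; apply: epsP inA inB => //.
by apply: lt_trans e_lt; exact: expR_gt0.
Qed.
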